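(* Let $H\in(0,1)$, $K\in(0,1]$, $\alpha>0$, let $B_{H,K}$ be a bi-fractional Brownian motion with parameters $H,K$, and let $B_{H,K}^{\mathrm{LT}}(t)=e^{-\alpha HK t}B_{H,K}(e^{\alpha t})$ for $t\in\mathbb{R}$. Then $B_{H,K}^{\mathrm{LT}}$ is a centred stationary Gaussian process.
   Context: A bi-fractional Brownian motion $B_{H,K}=\{B_{H,K}(t)\}_{t\ge0}$ with $H\in(0,1)$, $K\in(0,1]$ is a centred Gaussian process with covariance $$\mathbb{E}[B_{H,K}(t)B_{H,K}(s)]=2^{-K}\Bigl((t^{2H}+s^{2H})^{K}-|t-s|^{2HK}\Bigr),\qquad s,t\ge0.$$ Stationary means that all finite-dimensional distributions are invariant under time shifts. *)

(* Defs.v *)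
From mathcomp Require Import all_boot all_order all_algebra.
From mathcomp Require Import all_classical all_reals all_analysis.
From mathcomp Require Import measurable_realfun.

Set Implicit Arguments.
Unset Strict Implicit.
Unset Printing Implicit Defensive.

Import Order.TTheory GRing.Theory Num.Theory.
Import numFieldNormedType.Exports.

Local Open Scope classical_set_scope.
Local Open Scope ring_scope.

(* Gaussian law on the line with mean m and standard deviation s.  The
   degenerate case s = 0 is the point mass at m; it is treated separately
   because the library's normal_prob m 0 is the uniform law on [0, 1]. *)
Definition gaussian_law (R : realType) (m s : R) (A : set R) : \bar R :=
  if s == 0 then \d_m A else normal_prob m s A.

Section process.
Context {R : realType} {d : measure_display} {T : measurableType d}.
Context {P : probability T R}.

Definition centred_process (I : Type) (X : I -> {RV P >-> R}) : Prop :=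
  forall t : I, 'E_P[X t]%E = 0%E.

(* All finite-dimensional distributions are (possibly degenerate) multivariate
   normal, i.e. every finite linear combination of coordinates is Gaussian. *)
Definition gaussian_process (I : Type) (X : I -> {RV P >-> R}) : Prop :=
  forall (n : nat) (t : 'I_n -> I) (a : 'I_n -> R),
  exists m s : R, 0 <= s /\
    forall A : set R, measurable A ->
      pushforward P (fun w : T => \sum_(i < n) a i * X (t i) w) A
      = gaussian_law m s A.

(* n.-tuple R carries the product sigma-algebra. *)
Definition fin_dim_distribution (I : Type) (X : I -> {RV P >-> R})
    (n : nat) (t : 'I_n -> I) : set (n.-tuple R) -> \bar R :=
  pushforward P (fun w : T => [tuple X (t i) w | i < n]).

Definition stationary_process (X : R -> {RV P >-> R}) : Prop :=
  forall (n : nat) (t : 'I_n -> R) (h : R) (A : set (n.-tuple R)),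
    measurable A ->
    fin_dim_distribution X (fun i => t i + h) A = fin_dim_distribution X t A.

Definition bifbm_cov (H K s t : R) : R :=
  2 `^ (- K) *
  ((t `^ (2 * H) + s `^ (2 * H)) `^ K - `|t - s| `^ (2 * H * K)).

Definition is_bifbm (H K : R) (B : {nonneg R} -> {RV P >-> R}) : Prop :=
  [/\ centred_process B,
      gaussian_process B &
      forall s t : {nonneg R},
        'E_P[B t \* B s]%E = (bifbm_cov H K s%:num t%:num)%:E].

(* scale_mfun k f is the random variable fun w => f w * k. *)
Definition bifbm_LT (H K alpha : R) (B : {nonneg R} -> {RV P >-> R}) (t : R) :
    {RV P >-> R} :=
  scale_mfun (expR (- (alpha * H * K * t))) (B (expR (alpha * t))%:nng).

End process.

(* Main.v *)
(** The covariance of the bi-fractional Brownian motion is homogeneous of degree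
    2HK, so the covariance of the Lamperti transform is invariant under time
    shifts.  A centred Gaussian process is determined by its covariance:
    linear combinations of coordinates are centred Gaussian, hence their laws
    are fixed by their variances, and the Cramer-Wold device then fixes the
    finite-dimensional distributions.

    Cramer-Wold is proved without characteristic-function inversion.  Let C be
    the closure of the span of the functions x |-> cos (a.x + b) under bounded
    pointwise limits; expectations of members of C depend only on the laws of
    linear forms.  C is an algebra, hence stable under exp, and
      x |-> exp (- exp (k - k^2 (x_i - c)))
    lies in it, being the limit as N tends to infinity of the same expression
    with x_i - c replaced by N sin ((x_i - c) / N).  Letting k tend to infinity
    gives the indicator of x_i > c, and the sets whose indicator lies in C form
    a sigma-algebra. *)
Require Import Defs.
From mathcomp Require Import all_boot all_order all_algebra.
From mathcomp Require Import all_classical all_reals all_analysis.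
From mathcomp Require Import measurable_realfun ring lra.

Import Order.TTheory GRing.Theory Num.Theory.
Import numFieldNormedType.Exports.

Local Open Scope classical_set_scope.
Local Open Scope ring_scope.

(** * Bounded pointwise closure of a set of functions *)

(** In [bp_lim] the bound [C] is uniform in both [n] and [x], which is what dominated convergence
    under a probability measure asks for. *)
Inductive bp_closure {R : realType} {T : Type} (M : set (T -> R)) :
    (T -> R) -> Prop :=
| bp_base f : M f -> bp_closure M f
| bp_lin a f g : bp_closure M f -> bp_closure M g ->
    bp_closure M (fun x => a * f x + g x)
| bp_lim C (f_ : nat -> T -> R) f :
    (forall n, bp_closure M (f_ n)) ->
    (forall n x, `|f_ n x| <= C) ->
    (forall x, f_ n x @[n --> \oo] --> f x) ->
    bp_closure M f.

Section bp_closure_algebra.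
Context {R : realType} {T : Type} (M : set (T -> R)).
Hypothesis M_bounded : forall f, M f -> exists C : R, forall x, `|f x| <= C.
Hypothesis M1 : M (fun=> 1).
Hypothesis M_mul : forall f g, M f -> M g ->
  bp_closure M (fun x => f x * g x).
Local Notation cl := (bp_closure M).

Lemma bp_closure_bounded f : cl f -> exists C : R, forall x, `|f x| <= C.
Proof.
elim=> [{}f /M_bounded//|a {}f g _ [C fC] _ [D gD]|C f_ {}f _ _ fC cf].
  exists (`|a| * C + D) => x; rewrite (le_trans (ler_normD _ _))// lerD//.
  by rewrite normrM ler_wpM2l.
exists C => x; have cvn : `|f_ n x| @[n --> \oo] --> `|f x| by exact: cvg_norm.
rewrite -(cvg_lim _ cvn)//; apply: limr_le; first exact: cvgP cvn.
by apply: nearW => n; exact: fC.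
Qed.

Lemma bp_closure_cst c : cl (fun=> c).
Proof.
(* At this stage only the constant 1 is available, and [bp_lin] wants two members, so [c] is built
   from two copies of 1. *)
suff -> : (fun=> c) = (fun x : T => (c - 1) * 1 + 1 : R).
  by apply: bp_lin; exact: bp_base.
by apply/funext => x; rewrite mulr1 subrK.
Qed.

Lemma bp_closure_add f g : cl f -> cl g -> cl (fun x => f x + g x).
Proof.
move=> cf cg; rewrite (_ : (fun x => _) = fun x => 1 * f x + g x).
  exact: bp_lin.
by apply/funext => x; rewrite mul1r.
Qed.

Lemma bp_closure_scale a f : cl f -> cl (fun x => a * f x).
Proof.
move=> cf; rewrite (_ : (fun x => _) = fun x => a * f x + 0).
  by apply: bp_lin => //; exact: bp_closure_cst.
by apply/funext => x; rewrite addr0.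
Qed.

Lemma bp_closure_sub f g : cl f -> cl g -> cl (fun x => f x - g x).
Proof.
move=> cf cg; rewrite (_ : (fun x => _) = fun x => -1 * g x + f x).
  exact: bp_lin.
by apply/funext => x; rewrite mulN1r addrC.
Qed.

(** Two inductions: first on the right factor with the left one in [M], then on the left factor with
    the right one fixed in the closure. The fixed factor is bounded, so products along a bounded
    limit stay uniformly bounded. *)
Lemma bp_closure_mul f g : cl f -> cl g -> cl (fun x => f x * g x).
Proof.
suff mulM h k : M h -> cl k -> cl (fun x => h x * k x).
  move=> + clg; have [D gD] := bp_closure_bounded _ clg.
  elim=> [{}f Mf|a {}f h _ fg _ hg|C f_ {}f _ f_g fC cf].
  - exact: mulM.
  - rewrite (_ : (fun x => _) = fun x => a * (f x * g x) + h x * g x).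
      exact: bp_lin.
    by apply/funext => x; rewrite mulrDl mulrA.
  - apply: (@bp_lim _ _ _ (C * D) (fun n x => f_ n x * g x)) => //.
      by move=> n x; rewrite normrM ler_pM.
    by move=> x; apply: cvgMl; exact: cf.
move=> Mh; have [D hD] := M_bounded _ Mh.
elim=> [{}k Mk|a {}k l _ hk _ hl|C f_ {}f _ f_g fC cf].
- exact: M_mul.
- rewrite (_ : (fun x => _) = fun x => a * (h x * k x) + h x * l x).
    exact: bp_lin.
  by apply/funext => x; rewrite mulrDr mulrCA.
- apply: (@bp_lim _ _ _ (D * C) (fun n x => h x * f_ n x)) => //.
    by move=> n x; rewrite normrM ler_pM.
  by move=> x; apply: cvgMr; exact: cf.
Qed.

(** The partial sums of the exponential series are polynomials in [f], and if [C] bounds [f] they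
    are all bounded by [expR C]. *)
Lemma bp_closure_exp f : cl f -> cl (fun x => expR (f x)).
Proof.
move=> clf; have [C fC] := bp_closure_bounded _ clf.
(* The sign of [C] is read off at a point, since [T] may be empty. *)
have C_ge0 (x : T) : 0 <= C by rewrite (le_trans _ (fC x)).
apply: (@bp_lim _ _ _ (expR C) (fun n x => series (exp_coeff (f x)) n)).
- elim=> [|n ihn].
    rewrite (_ : (fun x => _) = fun=> 0); first exact: bp_closure_cst.
    by apply/funext => x; rewrite seriesEnat/= big_geq.
  rewrite (_ : (fun x => _) =
    fun x => series (exp_coeff (f x)) n + (n`!%:R^-1) * f x ^+ n).
    apply: bp_closure_add => //; apply: bp_closure_scale.
    elim: n {ihn} => [|n ihn].
      exact: bp_closure_cst.
    rewrite (_ : (fun x => _) = fun x => f x * f x ^+ n).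
      exact: bp_closure_mul.
    by apply/funext => x; rewrite exprS.
  by apply/funext => x; rewrite seriesSr exp_coeffE.
- move=> n x.
  have h : series (exp_coeff C) n <= expR C.
    apply: nondecreasing_cvgn_le; last exact: is_cvg_series_exp_coeff.
    apply/nondecreasing_seqP => m; rewrite seriesSr lerDl.
    exact: exp_coeff_ge0 (C_ge0 x).
  apply: le_trans h; rewrite !seriesEnat/=.
  apply: le_trans (ler_norm_sum _ _ _) _.
  apply: ler_sum => i _; rewrite !exp_coeffE normrM normrX.
  rewrite ger0_norm ?invr_ge0// ler_wpM2l ?invr_ge0//.
  by rewrite lerXn2r ?nnegrE// (C_ge0 x).
- by move=> x; exact: is_cvg_series_exp_coeff.
Qed.

End bp_closure_algebra.

(** * Two scalar limits: a bounded substitute for the identity, and a smooth step *)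

(** This is the derivative of [sin] at 0, equal to [cos 0 = 1], taken along the sequence
    [y / n.+1]. *)
Lemma cvg_scaled_sin {R : realType} (y : R) :
  n.+1%:R * sin (y / n.+1%:R) @[n --> \oo] --> y.
Proof.
(* The difference quotient is a limit at a punctured point, so the sequence must avoid 0. *)
have [->|y0] := eqVneq y 0.
  by under eq_fun do rewrite mul0r sin0 mulr0; exact: cvg_cst.
have /cvg_ex[/= l hl] : cvg (h^-1 *: (sin (h + 0) - sin 0) @[h --> (0:R)^']).
  have := @derivable_sin R 0; rewrite /derivable.
  by under eq_fun do rewrite /= scaler1.
have l1 : l = 1.
  rewrite -(cvg_lim _ hl)//.
  have := @derive_val _ _ _ _ _ _ _ (is_derive_sin (0 : R)); rewrite cos0 => <-.
  by rewrite /derive; congr (lim _); under [in RHS]eq_fun do rewrite /= scaler1.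
rewrite {}l1 in hl.
pose u (n : nat) : R := y / n.+1%:R.
have u0 n : u n != 0 by rewrite mulf_neq0// invr_neq0.
have cu : u n @[n --> \oo] --> 0.
  by rewrite -(mulr0 y); apply: cvgMr; exact: cvg_harmonic.
have /cvgr_dnbhsP/(_ u) := hl.
move=> /(_ (conj u0 cu)) h.
have -> : (fun n => n.+1%:R * sin (y / n.+1%:R)) =
    (fun n => y * ((u n)^-1 *: (sin (u n + 0) - sin 0))).
  apply/funext => n; rewrite addr0 sin0 subr0 /u invf_div /GRing.scale/=.
  by rewrite mulrA mulrCA divff// mulr1.
by rewrite -[X in _ --> X](mulr1 y); apply: cvgMr.
Qed.

(** The exponent [k - k^2 y] tends to minus infinity if [y > 0] and to plus infinity if [y <= 0].
    The linear term decides the case [y = 0], giving the value 0 there and hence a strict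
    inequality. *)
Lemma cvg_expNexp_step {R : realType} (y : R) :
  expR (- expR (k%:R - k%:R ^+ 2 * y)) @[k --> \oo] --> ((0 < y)%R%:R : R).
Proof.
have [y0|y0] := ltP 0 y.
  apply: (@squeeze_cvgr _ _ _ _ (fun k : nat => 1 - expR (- k%:R)) (fun=> 1)).
    near=> k.
    rewrite expR_le1 oppr_le0 expR_ge0 andbT.
    rewrite (le_trans _ (expR_ge1Dx _))// lerD2l lerN2 ler_expR.
    have k0 : 0 < k%:R :> R by rewrite ltr0n; near: k; exists 1%N.
    (* From [k y >= 2] follows [k - k^2 y <= - k]. *)
    have k2 : 2 / y <= k%:R by near: k; exact: nbhs_infty_ger.
    rewrite -ler_pdivlMr ?invr_gt0// invrK ?mulrA in k2.
    have : 2 <= k%:R * y by rewrite -ler_pdivrMr// mulrC in k2 *; lra.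
    nra.
  - rewrite -[X in _ --> X]subr0; apply: cvgB; first exact: cvg_cst.
    exact: cvgn_expR.
  - exact: cvg_cst.
apply: (@squeeze_cvgr _ _ _ _ (fun=> 0) (fun k : nat => expR (- k%:R))).
- near=> k; rewrite expR_ge0/= ler_expR lerN2.
  have h : k%:R <= k%:R - k%:R ^+ 2 * y :> R.
    by rewrite lerBrDr gerDl mulr_ge0_le0// sqr_ge0.
  apply: (le_trans h); apply: le_trans (expR_ge1Dx _).
  by rewrite lerDr.
- exact: cvg_cst.
- exact: cvgn_expR.
Unshelve. all: by end_near. Qed.

(** * Sets whose indicator lies in the closure *)

Section bp_closure_sets.
Context {R : realType} {T : Type} (M : set (T -> R)).
Hypothesis M_bounded : forall f, M f -> exists C : R, forall x, `|f x| <= C.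
Hypothesis M1 : M (fun=> 1).
Hypothesis M_mul : forall f g, M f -> M g ->
  bp_closure M (fun x => f x * g x).
Local Notation cl := (bp_closure M).

Lemma bp_closure_gt f c :
  (forall a b, cl (fun x => cos (a * f x + b))) ->
  cl (\1_[set x | c < f x]).
Proof.
move=> clcos.
have clsin a b : cl (fun x => sin (a * f x + b)).
  rewrite (_ : (fun x => _) = fun x => cos (a * f x + (b - pi / 2))) //.
  by apply/funext => x; rewrite addrA cosBpihalf.
have clE h : cl h -> cl (fun x => expR (- expR (h x))).
  move=> clh; apply: bp_closure_exp => //.
  rewrite (_ : (fun x => _) = fun x => -1 * expR (h x)).
    by apply: bp_closure_scale => //; exact: bp_closure_exp.
  by apply/funext => x; rewrite mulN1r.
have expNexp_norm (y : R) : `|expR (- expR y)| <= 1.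
  by rewrite ger0_norm ?expR_ge0// expR_le1 oppr_le0 expR_ge0.
apply: (@bp_lim _ _ _ 1
  (fun k x => expR (- expR (k%:R - k%:R ^+ 2 * (f x - c))))).
- move=> k.
  (* [f] may be unbounded and so outside the closure; the scaled sine is a member for each [n], and
     the outer double exponential keeps the limit bounded by 1. *)
  apply: (@bp_lim _ _ _ 1 (fun n x => expR (- expR (k%:R - k%:R ^+ 2 *
    (n.+1%:R * sin ((f x - c) / n.+1%:R)))))) => //.
  + move=> n; apply/clE/bp_closure_sub => //; first exact: bp_closure_cst.
    do 2 apply: bp_closure_scale => //.
    rewrite (_ : (fun x => _) =
      fun x => sin (n.+1%:R^-1 * f x + (- c / n.+1%:R))) //.
    by apply/funext => x; congr sin; rewrite mulrDl mulrC.
  + move=> x; apply: continuous_cvg; first exact: continuous_expR.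
    apply: cvgN; apply: continuous_cvg; first exact: continuous_expR.
    apply: cvgB; first exact: cvg_cst.
    by apply: cvgMr; exact: cvg_scaled_sin.
- by [].
- move=> x; rewrite indicE.
  rewrite (_ : (x \in _) = (0 < f x - c)); first exact: cvg_expNexp_step.
  by rewrite subr_gt0; apply/idP/idP; rewrite inE.
Qed.

(** Complements come from [1 - \1_A]. Finite intersections are products of indicators, and a
    countable intersection is their bounded limit; unions follow by complement. *)
Lemma bp_closure_sigma_algebra :
  sigma_algebra [set: T] [set A | cl \1_A].
Proof.
have clC A : cl \1_A -> cl \1_(~` A).
  move=> clA; rewrite (_ : \1_(~` A) = fun x => 1 - \1_A x).
    by apply: bp_closure_sub => //; exact: bp_closure_cst.
  apply/funext => x; rewrite !indicE in_setC.
  by case: (x \in A); rewrite ?subrr ?subr0.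
split => /=.
- by rewrite indic0; exact: bp_closure_cst.
- by move=> A; rewrite setTD; exact: clC.
- move=> A clA; rewrite -(setCK (\bigcup_i _)); apply: (clC).
  rewrite setC_bigcup.
  apply: (@bp_lim _ _ _ 1 (fun n x => \prod_(i < n) \1_(~` A i) x)).
  + elim=> [|n ih].
      rewrite (_ : (fun x => _) = fun=> 1); first exact: bp_closure_cst.
      by apply/funext => x; rewrite big_ord0.
    rewrite (_ : (fun x => _) =
      fun x => \prod_(i < n) \1_(~` A i) x * \1_(~` A n) x).
      by apply: bp_closure_mul => //; exact: clC.
    by apply/funext => x; rewrite big_ord_recr.
  + move=> n x; rewrite normr_prod; apply: prodr_ile1 => i _.
    by rewrite indicE normr_nat; case: (_ \in _); rewrite ?lexx ?ler01.
  + move=> x; have [xA|] := pselect ((\bigcap_i ~` A i) x).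
      rewrite indicE mem_set//; apply: cvg_near_cst; exists 0%N => //= n _.
      by rewrite big1// => i _; rewrite indicE mem_set//; exact: xA.
    move=> xNA; have [k _ Akx] : (\bigcup_i A i) x.
      by apply: contrapT => nA; apply: xNA; rewrite -setC_bigcup.
    rewrite indicE (memNset xNA); apply: cvg_near_cst.
    (* From [k.+1] on, the vanishing factor of index [k] is part of the product. *)
    exists k.+1 => // n /= kn.
    rewrite (bigD1 (Ordinal kn))//= indicE memNset ?mul0r//.
Qed.

End bp_closure_sets.

(** * The Cramer-Wold device *)

Section cramer_wold.
Context {R : realType} {d : measure_display} {T : measurableType d}.
Context (P : probability T R).

Lemma bounded_Lfun1 (f : T -> R) (C : R) : measurable_fun [set: T] f ->
  (forall x, `|f x| <= C) -> f \in Lfun P 1.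
Proof.
move=> mf fC; apply/Lfun1_integrable; apply: measurable_bounded_integrable => //.
  by rewrite [X in (X < _)%E]probability_setT ltry.
exists C; split; first exact: num_real.
by move=> y Cy x _; exact: le_trans (fC x) (ltW Cy).
Qed.

Lemma expectation_comp_eq_law (X Y : {RV P >-> R}) (f : R -> R) (C : R) :
  (forall A, measurable A -> pushforward P X A = pushforward P Y A) ->
  measurable_fun [set: R] f -> (forall x, `|f x| <= C) ->
  'E_P[f \o X]%E = 'E_P[f \o Y]%E.
Proof.
move=> XY mf fC.
have iP (Z : {RV P >-> R}) : P.-integrable setT ((EFin \o f) \o Z).
  apply/Lfun1_integrable; apply: (@bounded_Lfun1 (f \o Z) C).
    exact: measurableT_comp.
  by move=> x; exact: fC.
rewrite unlock.
transitivity (\int[distribution P X]_x (f x)%:E)%E.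
  by rewrite integral_distribution//; exact/measurable_EFinP.
transitivity (\int[distribution P Y]_x (f x)%:E)%E.
  by apply: eq_measure_integral => A mA _; exact: XY.
by rewrite integral_distribution//; exact/measurable_EFinP.
Qed.

Lemma expectation_bp_closure d' (U : measurableType d') (M : set (U -> R))
    (X Y : {RV P >-> U}) :
  (forall f, M f -> exists C : R, forall x, `|f x| <= C) ->
  (forall f, M f -> measurable_fun [set: U] f) ->
  (forall f, M f -> 'E_P[f \o X]%E = 'E_P[f \o Y]%E) ->
  forall f, bp_closure M f -> 'E_P[f \o X]%E = 'E_P[f \o Y]%E.
Proof.
move=> M_bounded M_measurable M_E f clf.
(* Measurability is carried along the induction, because linearity of the expectation and dominated
   convergence require it. *)
suff [] : measurable_fun [set: U] f /\ 'E_P[f \o X]%E = 'E_P[f \o Y]%E by [].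
elim: clf => {f} [f Mf|a f g clf [mf Ef] clg [mg Eg]|C f_ f _ fE fC cf].
- by split; [exact: M_measurable|exact: M_E].
- have m : measurable_fun [set: U] (fun x => a * f x + g x).
    by apply: measurable_funD => //; exact: measurable_funM.
  split => //.
  have [C fC] := bp_closure_bounded M M_bounded _ clf.
  have [D gD] := bp_closure_bounded M M_bounded _ clg.
  have L1 (h : U -> R) (Z : {RV P >-> U}) (K : R) : measurable_fun [set: U] h ->
      (forall x, `|h x| <= K) -> h \o Z \in Lfun P 1.
    move=> mh hK; apply: (@bounded_Lfun1 _ K); first exact: measurableT_comp.
    by move=> x; exact: hK.
  have E (Z : {RV P >-> U}) : 'E_P[((fun x => a * f x + g x) \o Z)%R]%E =
      (a%:E * 'E_P[f \o Z] + 'E_P[g \o Z])%E.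
    rewrite -expectationZl ?(L1 _ _ C)// -expectationD ?(L1 _ _ D)//.
      by congr expectation; apply/funext => x /=; rewrite mulrC.
    by apply: Lfun_scale => //; exact: (L1 _ _ C).
  by rewrite !E Ef Eg.
- have m : measurable_fun [set: U] f.
    by apply: (@measurable_fun_cvg _ _ _ _ f_) => // n; exact: (fE n).1.
  split => //.
  have E (Z : {RV P >-> U}) : 'E_P[f_ n \o Z]%E @[n --> \oo] --> 'E_P[f \o Z]%E.
    rewrite unlock.
    apply: (@dominated_cvg _ _ _ _ _ measurableT _ _ (EFin \o cst C)) => //.
    + move=> n; apply/measurable_EFinP; apply: measurableT_comp => //.
      exact: (fE n).1.
    + by move=> x _; apply: cvg_EFin; [exact: nearW|exact: cf].
    + exact: finite_measure_integrable_cst.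
    + by move=> n x _; rewrite /= lee_fin; exact: fC.
  have := E X; under eq_fun do rewrite (fE _).2.
  by move=> EX; rewrite -(cvg_lim _ EX)// (cvg_lim _ (E Y)).
Qed.

Lemma cramer_wold n (X Y : 'I_n -> {RV P >-> R}) :
  (forall (a : 'I_n -> R) A, measurable A ->
    pushforward P (fun w => \sum_(i < n) a i * X i w) A =
    pushforward P (fun w => \sum_(i < n) a i * Y i w) A) ->
  forall A : set (n.-tuple R), measurable A ->
    pushforward P (fun w => [tuple X i w | i < n]) A =
    pushforward P (fun w => [tuple Y i w | i < n]) A.
Proof.
move=> XY.
(* The phase [b] yields sines as well as cosines, and lets the product-to-sum formula express a
   product of two members as a combination of members. *)
pose M : set (n.-tuple R -> R) := [set f | exists (a : 'I_n -> R) (b : R),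
  f = fun x => cos (\sum_(i < n) a i * tnth x i + b)].
have M_bounded f : M f -> exists C : R, forall x, `|f x| <= C.
  by move=> [a [b ->]]; exists 1 => x; exact: cos_max.
have M1 : M (fun=> 1).
  exists (fun=> 0), 0; apply/funext => x.
  by rewrite big1 ?addr0 ?cos0// => i _; rewrite mul0r.
have M_mul f g : M f -> M g -> bp_closure M (fun x => f x * g x).
  move=> [a [b ->]] [a' [b' ->]].
  rewrite (_ : (fun x => _) = fun x =>
    2^-1 * cos (\sum_(i < n) (a i + a' i) * tnth x i + (b + b')) +
    2^-1 * cos (\sum_(i < n) (a i - a' i) * tnth x i + (b - b'))); last first.
    apply/funext => x.
    under [in RHS]eq_bigr do rewrite mulrDl.
    under [X in _ = _ + _ * cos (X + _)]eq_bigr do rewrite mulrBl.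
    rewrite sumrB big_split/=.
    set u := \sum_(i < n) a i * _; set v := \sum_(i < n) a' i * _.
    rewrite (_ : u + v + (b + b') = (u + b) + (v + b')); last by ring.
    rewrite (_ : u - v + (b - b') = (u + b) - (v + b')); last by ring.
    by move: (u + b) (v + b') => p q; rewrite cosD cosB; field.
  apply: bp_lin; first by apply: bp_base; do 2 eexists.
  by apply: bp_closure_scale => //; apply: bp_base; do 2 eexists.
have mT (Z : 'I_n -> {RV P >-> R}) :
    measurable_fun [set: T] (fun w => [tuple Z i w | i < n]).
  apply/measurable_fun_tnthP => i.
  rewrite (_ : _ \o _ = Z i)//.
  by apply/funext => w /=; rewrite tnth_mktuple.
pose V (Z : 'I_n -> {RV P >-> R}) : {RV P >-> n.-tuple R} :=
  mfun_Sub (mem_set (mT Z)).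
have mS (Z : 'I_n -> {RV P >-> R}) (a : 'I_n -> R) :
    measurable_fun [set: T] (fun w => \sum_(i < n) a i * Z i w).
  by apply: measurable_sum => i; exact: measurable_funM.
pose S a (Z : 'I_n -> {RV P >-> R}) : {RV P >-> R} :=
  mfun_Sub (mem_set (mS Z a)).
have mcos : measurable_fun [set: R] (@cos R).
  by apply: continuous_measurable_fun; exact: continuous_cos.
have E f : bp_closure M f -> 'E_P[f \o V X]%E = 'E_P[f \o V Y]%E.
  apply: expectation_bp_closure => // _ [a [b ->]].
    have ml : measurable_fun [set: n.-tuple R]
        (fun x : n.-tuple R => \sum_(i < n) a i * tnth x i).
      apply: measurable_sum => i.
      by apply: measurable_funM => //; exact: measurable_tnth.
    by apply: (measurableT_comp mcos); exact: measurable_funD.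
  (* Each generator factors through a linear form, so its expectation depends only on the law of
     that form. *)
  have EZ Z :
      'E_P[((fun x => cos (\sum_(i < n) a i * tnth x i + b)) \o V Z)%R]%E =
      'E_P[((fun x => cos (x + b)) \o S a Z)%R]%E.
    congr expectation; apply/funext => w /=; congr (cos (_ + _)).
    by apply: eq_bigr => i _; rewrite tnth_mktuple.
  rewrite !EZ; apply: (expectation_comp_eq_law _ _ _ 1); first exact: XY.
    by apply: (measurableT_comp mcos); exact: measurable_funD.
  by move=> x; exact: cos_max.
(* The product sigma-algebra is generated by preimages under coordinates, and that of the line by
   the rays []c, +oo[]; it is enough to treat the half-spaces [c < tnth x i]. *)
have clM : measurable `<=` [set A : set (n.-tuple R) | bp_closure M \1_A].
  have sM := bp_closure_sigma_algebra M M_bounded M1 M_mul.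
  apply: smallest_sub => //.
  rewrite -bigcup_seq => B [i _ [C mC <-]]; rewrite setTI.
  suff: image_set_system setT (fun x : n.-tuple R => tnth x i)
      [set A | bp_closure M \1_A] C by rewrite /image_set_system/= setTI.
  have {}mC : <<s RGenOInfty.G (R := R) >> C.
    by have := mC; rewrite -[X in _ -> X C]RGenOInfty.measurableE.
  apply: smallest_sub mC; first exact: sigma_algebra_image.
  move=> _ [c ->]; rewrite /image_set_system/= setTI.
  rewrite (_ : _ @^-1` _ = [set x | c < tnth x i]); last first.
    by apply/seteqP; split => x /=; rewrite in_itv/= andbT.
  apply: bp_closure_gt => // a b; apply: bp_base.
  exists (fun j => if j == i then a else 0), b; apply/funext => x.
  rewrite (bigD1 i)//= eqxx big1 ?addr0// => j /negbTE ->.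
  by rewrite mul0r.
move=> A mA.
have EA (Z : 'I_n -> {RV P >-> R}) :
    pushforward P (fun w => [tuple Z i w | i < n]) A = 'E_P[\1_A \o V Z]%E.
  rewrite -[LHS](expectation_indic P (A := V Z @^-1` A)); last first.
    by rewrite -[X in measurable X]setTI; exact: (mT Z).
  by congr expectation; apply/funext => w /=; rewrite !indicE.
by rewrite !EA; apply: E; exact: clM.
Qed.

End cramer_wold.

(** * Integrals against normal laws *)

Section normal_moments.
Context {R : realType}.
Local Notation mu := (@lebesgue_measure R).
Local Open Scope ereal_scope.

(** The Radon-Nikodym derivative and [normal_pdf] have the same integral over every measurable set,
    so they agree almost everywhere. *)
Lemma ge0_integral_normal_prob (m s : R) (f : R -> \bar R) :
  measurable_fun [set: R] f -> (forall x, 0 <= f x) ->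
  \int[normal_prob m s]_x f x = \int[mu]_x (f x * (normal_pdf m s x)%:E).
Proof.
move=> mf f0; have dom := normal_prob_dominates m s.
rewrite -(Radon_Nikodym_SigmaFinite.change_of_variables dom)//.
have mpdf : measurable_fun [set: R] (EFin \o normal_pdf m s).
  by apply/measurable_EFinP; exact: measurable_normal_pdf.
have mRN := measurable_int _ (Radon_Nikodym_SigmaFinite.f_integrable dom).
apply: ae_eq_integral => //; [exact: emeasurable_funM..|].
apply: ae_eqe_mul2l; apply: integral_ae_eq => //.
  exact: Radon_Nikodym_SigmaFinite.f_integrable.
by move=> A _ mA; rewrite -Radon_Nikodym_SigmaFinite.f_integral.
Qed.

Lemma ge0_integral_normal_prob_std (m s : R) (g : R -> R) :
  (0 < s)%R -> continuous g -> (forall x, 0 <= g x)%R ->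
  \int[normal_prob m s]_x (g x)%:E =
  \int[normal_prob 0 1]_z (g (m + s * z)%R)%:E.
Proof.
move=> s0 cg g0.
have cF : continuous (fun z : R => m + s * z)%R.
  move=> z; apply: cvgD; first exact: cvg_cst.
  by apply: cvgM; [exact: cvg_cst|exact: cvg_id].
have mg : measurable_fun [set: R] g by exact: continuous_measurable_fun.
have mF := continuous_measurable_fun cF.
have mgE : measurable_fun [set: R] (EFin \o g) by exact/measurable_EFinP.
have mgF : measurable_fun [set: R] (fun z => (g (m + s * z)%R)%:E).
  by apply/measurable_EFinP; exact: measurableT_comp mF.
rewrite (ge0_integral_normal_prob m s _ mgE)//.
rewrite (ge0_integral_normal_prob 0 1 _ mgF) => [|x]; last by rewrite lee_fin.
have dF (z : R^o) : is_derive z 1%R (fun z : R^o => (m + s * z)%R : R^o) s.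
  by apply: is_derive_eq; rewrite add0r mul1r /GRing.scale/= mulr1.
have F'E : (fun z : R => (m + s * z)%R)^`()%classic = (cst s : R -> R).
  by apply/funext => z; rewrite derive1E derive_val.
under eq_integral do rewrite -EFinM.
rewrite (@increasing_ge0_integration_by_substitutionT _
  (fun z : R => m + s * z)%R (fun x => g x * normal_pdf m s x)%R).
- apply: eq_integral => z _; rewrite F'E !fctE/= -EFinM; congr EFin.
  rewrite -mulrA; congr (_ * _)%R.
  (* The Jacobian [s] cancels the factor [1 / s] of the peak, and the two exponents coincide. *)
  rewrite !normal_pdfE ?oner_eq0 ?gt_eqF// /normal_peak /normal_fun.
  rewrite expr1n mul1r -mulrnAr sqrtrM ?sqr_ge0// sqrtr_sqr gtr0_norm//.
  rewrite (_ : - (m + s * z - m) ^+ 2 / (s ^+ 2 *+ 2) =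
    - (z - 0) ^+ 2 / (1 *+ 2))%R; last by field; rewrite gt_eqF.
  by rewrite invfM mulrC !mulrA mulfV ?gt_eqF// mul1r.
- by move=> x y xy; rewrite ltrD2l ltr_pM2l.
- by rewrite F'E => ?; exact: cvg_cst.
- by rewrite F'E; exact: is_cvg_cst.
- by rewrite F'E; exact: is_cvg_cst.
- by move=> x.
- apply/cvgrNyPle => A; near=> z.
  rewrite -lerBrDl -ler_pdivlMl//; near: z; exact: nbhs_ninfty_le.
- apply/cvgryPge => A; near=> z.
  rewrite -lerBlDl -ler_pdivrMl//; near: z; exact: nbhs_pinfty_ge.
- move=> x; apply: cvgM; first exact: cg.
  by apply: continuous_normal_pdf; rewrite gt_eqF.
- by move=> x; rewrite mulr_ge0// normal_pdf_ge0.
Unshelve. all: by end_near. Qed.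

(** Splitting the line at 0 and flipping the negative half gives two integrals over [[0, +oo[],
    which the reflection exchanges. *)
Lemma ge0_integral_lebesgueN (G : R -> R) :
  continuous G -> (forall x, 0 <= G x)%R ->
  \int[mu]_x (G (- x)%R)%:E = \int[mu]_x (G x)%:E.
Proof.
have split_ge0 (H : R -> R) : continuous H -> (forall x, 0 <= H x)%R ->
    \int[mu]_x (H x)%:E = \int[mu]_(x in `[0%R, +oo[) (H (- x)%R)%:E +
                          \int[mu]_(x in `[0%R, +oo[) (H x)%:E.
  move=> cH H0.
  have mH : measurable_fun [set: R] (EFin \o H).
    by apply/measurable_EFinP; exact: continuous_measurable_fun.
  have -> : [set: R] = `]-oo, (- 0)%R] `|` `]0%R, +oo[.
    by rewrite oppr0 -itv_bndbnd_setU// set_itvE.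
  rewrite ge0_integral_setU//=.
  - congr (_ + _).
      rewrite ge0_integration_by_substitutionNy//.
      exact: continuous_subspaceT.
    by rewrite integral_itv_obnd_cbnd//; exact: measurable_funTS.
  - exact: measurable_funTS.
  - by move=> x _; rewrite lee_fin.
  - rewrite oppr0; apply/disj_set2P; rewrite -subset0 => x [] /=.
    by rewrite !in_itv/= andbT => /le_lt_trans /[apply]; rewrite ltxx.
move=> cG G0; rewrite [RHS]split_ge0// [LHS]split_ge0//; last first.
  by move=> x; apply: continuous_comp; [exact: opp_continuous|exact: cG].
by under eq_integral do rewrite opprK; rewrite addeC.
Qed.

Lemma ge0_integral_normal_prob01N (g : R -> R) :
  continuous g -> (forall x, 0 <= g x)%R ->
  \int[normal_prob 0 1]_z (g (- z)%R)%:E = \int[normal_prob 0 1]_z (g z)%:E.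
Proof.
move=> cg g0.
have mg : measurable_fun [set: R] g by exact: continuous_measurable_fun.
have mgE : measurable_fun [set: R] (EFin \o g) by exact/measurable_EFinP.
have mgN : measurable_fun [set: R] (fun z => (g (- z)%R)%:E).
  by apply/measurable_EFinP; exact: measurableT_comp.
rewrite !ge0_integral_normal_prob//; last by move=> x; rewrite lee_fin.
rewrite -(ge0_integral_lebesgueN (fun x => g x * normal_pdf 0 1 x)%R).
- apply: eq_integral => x _; rewrite -EFinM; congr (_ * _)%:E.
  by rewrite !normal_pdfE ?oner_eq0// /normal_fun !subr0 sqrrN.
- move=> x; apply: cvgM; first exact: cg.
  by apply: continuous_normal_pdf; rewrite oner_eq0.
- by move=> x; rewrite mulr_ge0// normal_pdf_ge0.
Qed.

(** Kept as an extended real: positivity is enough to recover a standard deviation from a finite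
    second moment. *)
Definition normal_prob01_moment2 : \bar R :=
  \int[normal_prob 0 1]_z ((z : R) ^+ 2)%:E.

(** Otherwise [z ^+ 2] vanishes almost everywhere, so the law is carried by the point 0; that point
    is null, which contradicts total mass 1. *)
Lemma normal_prob01_moment2_gt0 : 0 < normal_prob01_moment2.
Proof.
rewrite /normal_prob01_moment2 lt_neqAle integral_ge0 ?andbT; last first.
  by move=> x _; rewrite lee_fin sqr_ge0.
apply/eqP => c0.
have : ae_eq (normal_prob (0:R) 1) setT (fun z : R => (z ^+ 2)%:E) (cst 0).
  apply/ae_eq_integral_abs => //.
    by apply/measurable_EFinP; exact: measurable_funX.
  rewrite [RHS]c0; apply: eq_integral => z _.
  by rewrite gee0_abs// lee_fin sqr_ge0.
move=> [A [mA A0 subA]].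
have : normal_prob (0 : R) 1 (A `|` [set 0%R]) = 0.
  apply/eqP; rewrite eq_le measure_ge0 andbT.
  apply: (@le_trans _ _ (normal_prob 0 1 A + normal_prob 0 1 [set 0%R])).
    exact: measureU2.
  by rewrite A0 add0e /normal_prob integral_set1.
rewrite (_ : A `|` [set 0%R] = setT).
  by rewrite probability_setT => /eqP; rewrite onee_eq0.
apply/seteqP; split => // z _ /=.
have [->|z0] := eqVneq z 0%R; [by right|left].
by apply: subA => /= /(_ I) [] /eqP; rewrite expf_eq0/= (negbTE z0).
Qed.

End normal_moments.

(** * Mean and second moment determine a Gaussian law *)

Section gaussian_law.
Context {R : realType} {d : measure_display} {T : measurableType d}.
Context (P : probability T R).
Local Open Scope ereal_scope.

Definition has_gaussian_law (Y : {RV P >-> R}) (m s : R) :=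
  forall A : set R, measurable A -> pushforward P Y A = gaussian_law m s A.

(** The form [m + s * z] also covers the point mass: for [s = 0] the integrand is the constant
    [g m]. *)
Lemma ge0_integral_gaussian_law (Y : {RV P >-> R}) (m s : R) (g : R -> R) :
  (0 <= s)%R -> has_gaussian_law Y m s ->
  continuous g -> (forall x, 0 <= g x)%R ->
  \int[P]_w (g (Y w))%:E = \int[normal_prob 0 1]_z (g (m + s * z)%R)%:E.
Proof.
move=> s0 Yms cg g0.
have mg : measurable_fun [set: R] (EFin \o g).
  by apply/measurable_EFinP; exact: continuous_measurable_fun.
have -> : \int[P]_w (g (Y w))%:E = \int[distribution P Y]_x (g x)%:E.
  by rewrite ge0_integral_distribution// => x; rewrite lee_fin.
have [s00|s00] := eqVneq s 0%R.
  rewrite (eq_measure_integral (dirac m : {measure set R -> \bar R})); last first.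
    by move=> A mA _; rewrite /= [LHS]Yms// /gaussian_law s00 eqxx.
  rewrite integral_dirac// diracT mul1e s00.
  under eq_integral do rewrite mul0r addr0.
  rewrite integral_cst//.
  by rewrite [X in _ * X](@probability_setT _ _ _ (normal_prob 0 1)) mule1.
rewrite -(ge0_integral_normal_prob_std m s g)//; last first.
  by rewrite lt_neqAle eq_sym s00.
(* [normal_prob] is a measure on [measurableTypeR R], whose display differs
   from that of [R]. *)
pose i : measurableTypeR R -> R := idfun.
have mi : measurable_fun [set: measurableTypeR R] i.
  by move=> _ A mA; rewrite setTI.
pose i' : {mfun measurableTypeR R >-> R} := mfun_Sub (mem_set mi).
rewrite (eq_measure_integral (distribution (normal_prob m s) i')).
  by rewrite ge0_integral_distribution// => x; rewrite lee_fin.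
by move=> A mA _; rewrite /= [LHS]Yms// /gaussian_law (negbTE s00).
Qed.

(** By symmetry of the standard normal law, the positive and negative parts of [Y - m] have the same
    integral, finite by integrability, and cancel. *)
Lemma expectation_gaussian_law (Y : {RV P >-> R}) (m s : R) :
  (Y : T -> R) \in Lfun P 1 -> (0 <= s)%R -> has_gaussian_law Y m s ->
  'E_P[Y] = m%:E.
Proof.
move=> Y1 s0 Yms.
have L1 : (fun w => Y w - m)%R \in Lfun P 1.
  by rewrite rpredB// Lfun_cst.
suff E0 : 'E_P[(fun w => Y w - m)%R] = 0.
  have := expectation_fin_num Y1; have := expectationB Y1 (Lfun_cst P m 1).
  rewrite E0 expectation_cst; case: ('E_P[Y]) => [r|//|//].
  by rewrite -EFinB => -[] /esym/eqP; rewrite subr_eq0 => /eqP ->.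
rewrite unlock integralE.
have cpos (f : R -> R) : continuous f -> continuous (fun x => Num.max (f x) 0)%R.
  by move=> cf x; apply: continuous_max; [exact: cf|exact: cvg_cst].
have cB (x : R) : {for x, continuous (fun x : R => x - m)%R}.
  by apply: cvgB; [exact: cvg_id|exact: cvg_cst].
have iY := (Lfun1_integrable _ _).1 L1.
have maxE (x y : R) : maxe x%:E y%:E = (Num.max x y)%:E by rewrite EFin_max.
have posE : \int[P]_w ((EFin \o (fun w => Y w - m)%R)^\+ w) =
    \int[normal_prob 0 1]_z (Num.max (s * z) 0)%:E.
  under eq_integral do rewrite funeposE /= maxE.
  rewrite (ge0_integral_gaussian_law Y m s (fun x => Num.max (x - m) 0)%R)//.
  - by apply: eq_integral => z _; rewrite addrAC subrr add0r.
  - by apply: cpos => x; exact: cB.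
  - by move=> x; rewrite le_max lexx orbT.
have negE : \int[P]_w ((EFin \o (fun w => Y w - m)%R)^\- w) =
    \int[normal_prob 0 1]_z (Num.max (s * z) 0)%:E.
  under eq_integral do rewrite funenegE /= maxE.
  rewrite (ge0_integral_gaussian_law Y m s (fun x => Num.max (- (x - m)) 0)%R)//.
  - rewrite -(ge0_integral_normal_prob01N (fun z => Num.max (s * z) 0)%R).
    + by apply: eq_integral => z _; rewrite addrAC subrr add0r mulrN.
    + by apply: cpos => x; apply: cvgM; [exact: cvg_cst|exact: cvg_id].
    + by move=> x; rewrite le_max lexx orbT.
  - by apply: cpos => x; apply: cvgN; exact: cB.
  - by move=> x; rewrite le_max lexx orbT.
have := integrable_pos_fin_num measurableT iY.
rewrite posE negE => fin.
by rewrite subee.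
Qed.

Lemma moment2_gaussian_law (Y : {RV P >-> R}) (s : R) :
  (0 <= s)%R -> has_gaussian_law Y 0 s ->
  'E_P[(fun w => Y w ^+ 2)%R] =
  (s ^+ 2)%:E * normal_prob01_moment2.
Proof.
move=> s0 Ys; rewrite unlock.
rewrite (ge0_integral_gaussian_law Y 0 s (fun x => x ^+ 2)%R)//.
- under eq_integral do rewrite add0r exprMn EFinM.
  rewrite ge0_integralZl//.
  + by apply/measurable_EFinP; exact: measurable_funX.
  + by move=> x _; rewrite lee_fin sqr_ge0.
  + by rewrite lee_fin sqr_ge0.
- exact: sqr_continuous.
- by move=> x; rewrite sqr_ge0.
Qed.

(** The means force [m1 = m2 = 0], and the second moments are then [s1 ^+ 2] and [s2 ^+ 2] times the
    same positive constant. *)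
Lemma centred_gaussian_law_unique (Y1 Y2 : {RV P >-> R}) (m1 s1 m2 s2 : R) :
  (0 <= s1)%R -> has_gaussian_law Y1 m1 s1 ->
  (0 <= s2)%R -> has_gaussian_law Y2 m2 s2 ->
  (Y1 : T -> R) \in Lfun P 1 -> (Y2 : T -> R) \in Lfun P 1 ->
  'E_P[Y1] = 0 -> 'E_P[Y2] = 0 ->
  'E_P[(fun w => Y1 w ^+ 2)%R] \is a fin_num ->
  'E_P[(fun w => Y1 w ^+ 2)%R] = 'E_P[(fun w => Y2 w ^+ 2)%R] ->
  forall A, measurable A -> pushforward P Y1 A = pushforward P Y2 A.
Proof.
move=> s10 Y1ms s20 Y2ms L1 L2.
rewrite (expectation_gaussian_law _ _ _ L1 s10 Y1ms).
rewrite (expectation_gaussian_law _ _ _ L2 s20 Y2ms).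
move=> [m10] [m20]; rewrite {}m10 {}m20 in Y1ms Y2ms *.
rewrite (moment2_gaussian_law _ _ s10 Y1ms) (moment2_gaussian_law _ _ s20 Y2ms).
have := @normal_prob01_moment2_gt0 R.
move: (@normal_prob01_moment2 R) => c c0 cfin ceq.
suff s12 : s1 = s2.
  by move=> A mA; rewrite (Y1ms A mA) (Y2ms A mA) s12.
case: c c0 cfin ceq => [c| |]//.
- rewrite lte_fin => c0 _ [] h; apply/eqP; rewrite -(eqrXn2 (n := 2))//.
  apply/eqP; apply: (mulIf (lt0r_neq0 c0)). exact: h.
(* If the constant were infinite, finite second moments would force both deviations to be 0. *)
- move=> _.
  have sy (s : R) : (0 <= s)%R -> (s ^+ 2)%:E * +oo \is a fin_num -> s = 0%R.
    rewrite le_eqVlt => /predU1P[<-//|s0].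
    by rewrite gt0_muley// lte_fin exprn_gt0.
  by move=> /[dup] /(sy _ s10) -> + e; rewrite e => /(sy _ s20) ->.
Qed.

End gaussian_law.

(** * Linear combinations, and centred Gaussian processes with equal covariances *)

Section linear_combination.
Context {R : realType} {d : measure_display} {T : measurableType d}.
Context (P : probability T R).

Lemma Lfun2_of_moment2 (f : {RV P >-> R}) :
  ('E_P[f \* f] < +oo)%E -> (f : T -> R) \in Lfun P 2%:E.
Proof.
move=> f2; rewrite inE; apply/andP; split; rewrite inE/=; first exact: measurable_funP.
rewrite /finite_norm unlock /Lnorm poweR_lty//.
move: f2; rewrite unlock; congr (_ < _)%E; apply: eq_integral => w _.
by rewrite /= powR_mulrn// real_normK ?num_real// expr2.
Qed.

Lemma Lfun_lincomb (I : Type) (p : R) (s : seq I) (a : I -> R)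
    (F : I -> T -> R) : 1 <= p -> (forall i, F i \in Lfun P p%:E) ->
  (fun w => \sum_(i <- s) a i * F i w) \in Lfun P p%:E.
Proof.
move=> p1 FL; elim: s => [|i s ih].
  by under eq_fun do rewrite big_nil; exact: Lfun_cst.
rewrite (_ : (fun w => _) =
  (a i \o* F i) + (fun w => \sum_(i <- s) a i * F i w)).
  by rewrite rpredD// ?Lfun_scale.
by apply/funext => w; rewrite big_cons mulrC.
Qed.

Lemma expectation_lincomb (I : Type) (s : seq I) (a : I -> R)
    (F : I -> T -> R) : (forall i, F i \in Lfun P 1) ->
  ('E_P[(fun w => \sum_(i <- s) a i * F i w)%R] =
   \sum_(i <- s) (a i)%:E * 'E_P[F i])%E.
Proof.
move=> FL; elim: s => [|i s ih].
  under eq_fun do rewrite big_nil.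
  by rewrite big_nil -[RHS](expectation_cst P 0).
rewrite big_cons -ih -expectationZl// -expectationD//.
- by congr expectation; apply/funext => w; rewrite big_cons/= mulrC.
- exact: Lfun_scale.
- exact: Lfun_lincomb.
Qed.

(** By [cramer_wold] it suffices to compare linear forms. These are centred Gaussian, and their
    second moments are quadratic forms in the covariances, equal by hypothesis. *)
Lemma centred_gaussian_fdd (I : Type) (X : I -> {RV P >-> R})
    (c : I -> I -> R) n (t u : 'I_n -> I) :
  centred_process X -> gaussian_process X ->
  (forall i j, 'E_P[X i \* X j]%E = (c i j)%:E) ->
  (forall k l, c (t k) (t l) = c (u k) (u l)) ->
  forall A, measurable A ->
    fin_dim_distribution X t A = fin_dim_distribution X u A.
Proof.
move=> X0 XG Xc ctu; apply: (cramer_wold P n (X \o t) (X \o u)) => a.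
have L2 i : (X i : T -> R) \in Lfun P 2%:E.
  by apply: Lfun2_of_moment2; rewrite Xc ltry.
have L1 i : (X i : T -> R) \in Lfun P 1.
  apply: Lfun_subset12; last exact: L2.
  by rewrite [X in X \is a _](@probability_setT _ _ _ P).
pose S (v : 'I_n -> I) w := \sum_(i < n) a i * X (v i) w.
have mS v : measurable_fun [set: T] (S v).
  by apply: measurable_sum => i; exact: measurable_funM.
pose Y v : {RV P >-> R} := mfun_Sub (mem_set (mS v)).
have Y1 v : (Y v : T -> R) \in Lfun P 1 by exact: Lfun_lincomb.
have Y2 v : (Y v : T -> R) \in Lfun P 2%:E by apply: Lfun_lincomb; rewrite ?ler1n.
have EY v : 'E_P[Y v]%E = 0%E.
  rewrite [LHS](expectation_lincomb _ _ a (fun i => X (v i)))//.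
  by rewrite big1// => i _; rewrite X0 mule0.
have EY2 v : 'E_P[(fun w => Y v w ^+ 2)%R]%E =
    (\sum_(i < n) \sum_(j < n) a i * (a j * c (v i) (v j)))%:E.
  have -> : (fun w => Y v w ^+ 2) =
      (fun w => \sum_(i < n) a i * (X (v i) \* Y v) w).
    apply/funext => w; rewrite expr2 {1}/Y/= /S mulr_suml.
    by apply: eq_bigr => i _; rewrite mulrA.
  rewrite expectation_lincomb; last by move=> i; exact: Lfun2_mul_Lfun1.
  rewrite -sumEFin; apply: eq_bigr => i _; rewrite -mulr_sumr EFinM; congr (_ * _)%E.
  have -> : X (v i) \* Y v =
      (fun w => \sum_(j < n) a j * (X (v i) \* X (v j)) w).
    apply/funext => w /=; rewrite /S mulr_sumr.
    by apply: eq_bigr => j _; rewrite mulrCA.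
  rewrite expectation_lincomb; last by move=> j; exact: Lfun2_mul_Lfun1.
  by rewrite -sumEFin; apply: eq_bigr => j _; rewrite Xc EFinM.
have [m1 [s1 [s10 Yt]]] := XG n t a.
have [m2 [s2 [s20 Yu]]] := XG n u a.
apply: (centred_gaussian_law_unique P (Y t) (Y u) m1 s1 m2 s2) => //.
- by rewrite EY2.
- rewrite !EY2; congr EFin; do 2 apply: eq_bigr => ? _.
  by rewrite ctu.
Qed.

End linear_combination.

(** * Covariance of the bi-fractional Brownian motion and of its Lamperti transform *)

(** The inner sum releases [l] to the power [2H], which the outer power turns into [2HK]; the
    increment term releases the same factor. *)
Lemma bifbm_cov_homogeneous (R : realType) (H K l s t : R) :
  0 < l -> 0 <= s -> 0 <= t ->
  bifbm_cov H K (l * s) (l * t) = l `^ (2 * H * K) * bifbm_cov H K s t.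
Proof.
move=> l0 s0 t0; rewrite /bifbm_cov.
rewrite -mulrBr normrM (gtr0_norm l0) !powRM ?(ltW l0)//.
rewrite -mulrDr powRM ?powR_ge0 ?addr_ge0 ?powR_ge0//.
by rewrite -powRrM -mulrBr mulrCA.
Qed.

Section bifbm_LT.
Context {R : realType} {d : measure_display} {T : measurableType d}.
Context {P : probability T R}.

Lemma bifbm_LT_cov (H K alpha : R) (B : {nonneg R} -> {RV P >-> R}) (s t : R) :
  is_bifbm H K B ->
  'E_P[bifbm_LT H K alpha B s \* bifbm_LT H K alpha B t]%E =
  (expR (- (alpha * H * K * (s + t))) *
    bifbm_cov H K (expR (alpha * t)) (expR (alpha * s)))%:E.
Proof.
move=> [_ _ Bc].
have L2 u : (B u : T -> R) \in Lfun P 2%:E.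
  by apply: Lfun2_of_moment2; rewrite Bc ltry.
(* The times are swapped because [is_bifbm] pairs [B t \* B s] with the covariance at [s], [t]. *)
rewrite EFinM -(Bc (expR (alpha * t))%:nng (expR (alpha * s))%:nng).
rewrite -expectationZl ?Lfun2_mul_Lfun1//; congr expectation.
apply/funext => w /=; rewrite mulrDr opprD expRD; ring.
Qed.

End bifbm_LT.

Theorem theorem2p13 (R : realType) (d : measure_display)
  (T : measurableType d) (P : probability T R)
  (H K alpha : R) (H_gt0 : 0 < H) (H_lt1 : H < 1)
  (K_gt0 : 0 < K) (K_le1 : K <= 1) (alpha_gt0 : 0 < alpha)
  (B : {nonneg R} -> {RV P >-> R}) (bifbmB : is_bifbm H K B) :
  [/\ centred_process (bifbm_LT H K alpha B),
      stationary_process (bifbm_LT H K alpha B) &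
      gaussian_process (bifbm_LT H K alpha B)].
Proof.
have [B0 BG Bc] := bifbmB.
have L1 u : (B u : T -> R) \in Lfun P 1.
  apply: Lfun_subset12; first by rewrite [X in X \is a _](@probability_setT _ _ _ P).
  by apply: Lfun2_of_moment2; rewrite Bc ltry.
have X0 : centred_process (bifbm_LT H K alpha B).
  by move=> t; rewrite expectationZl// B0 mule0.
have XG : gaussian_process (bifbm_LT H K alpha B).
  move=> n t a.
  (* The deterministic Lamperti factors are absorbed into the coefficients of a linear form of
     [B]. *)
  have [m [s [s0 h]]] := BG n (fun i => (expR (alpha * t i))%:nng)
    (fun i => a i * expR (- (alpha * H * K * t i))).
  exists m, s; split => // A mA; rewrite -h//.
  rewrite (_ : (fun w => _) = (fun w => \sum_(i < n)
    a i * expR (- (alpha * H * K * t i)) * B (expR (alpha * t i))%:nng w))//.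
  by apply/funext => w; apply: eq_bigr => i _ /=; ring.
split => // n t h A mA.
pose c s u := expR (- (alpha * H * K * (s + u))) *
  bifbm_cov H K (expR (alpha * u)) (expR (alpha * s)).
have c_shift s u : c (s + h) (u + h) = c s u.
  rewrite /c !mulrDr !(expRD (alpha * _)) !(mulrC _ (expR (alpha * h))).
  (* A shift by [h] dilates both times by [expR (alpha * h)]; the factor
     [expR (2 * alpha * H * K * h)] so released cancels the change of the prefactor. *)
  rewrite bifbm_cov_homogeneous ?expR_ge0 ?expR_gt0// mulrA; congr (_ * _).
  rewrite -expRM -expRD; congr expR; ring.
apply: (centred_gaussian_fdd P _ _ c n _ t X0 XG _ _ A mA).
  by move=> s u; exact: bifbm_LT_cov.
by move=> k l; exact: c_shift.
Qed.
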